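(* For every $n$-HCFP $\mathcal{H}$ and every formula $\varphi$ of the logic $\mathsf{E(U,X)}$ with regular atomic predicates, the set of $n$-stores satisfying $\varphi$ in $\mathcal{H}$ is regular and effectively computable (as a finite automaton) from $\mathcal{H}$ and $\varphi$.
   Context: Higher-order stores over a finite alphabet $\Gamma$: a 1-store is a sequence $[a_1\ldots a_l]$, $a_i\in\Gamma$, $l\ge0$; for $n\ge2$ an $n$-store is a nonempty sequence $[s_1\ldots s_l]$ of $(n-1)$-stores. An $n$-store is identified with its word $w(s)=[w(s_1)\ldots w(s_l)]$ over $\Gamma'=\Gamma\cup\{[,]\}$; a set of $n$-stores is regular if its set of words is accepted by a finite automaton over $\Gamma'$. Operations: on 1-stores, $\mathit{push}_1^w([a_1\ldots a_l])=[w a_2\ldots a_l]$ for $w\in\Gamma^*$ and $\mathit{top}_1([a_1\ldots a_l])=a_1$ (defined only when $l\ge1$). On $n$-stores $s=[s_1\ldots s_l]$, $n>1$: $\mathit{push}_1^w(s)=[\mathit{push}_1^w(s_1)\,s_2\ldots s_l]$; for $2\le k<n$, $\mathit{push}_k(s)=[\mathit{push}_k(s_1)\,s_2\ldots s_l]$ and $\mathit{pop}_k(s)=[\mathit{pop}_k(s_1)\,s_2\ldots s_l]$; $\mathit{push}_n(s)=[s_1 s_1 s_2\ldots s_l]$; $\mathit{pop}_n(s)=[s_2\ldots s_l]$ if $l>1$, undefined otherwise; $\mathit{top}_k(s)=\mathit{top}_k(s_1)$ for $k<n$, $\mathit{top}_n(s)=s_1$. $O_n=\{\mathit{push}_k,\mathit{pop}_k\mid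 k\in[2,n]\}\cup\{\mathit{push}_1^w\mid w\in\Gamma^*\}$. An $n$-HCFP is $\mathcal{H}=(\Gamma,\Delta)$ with $\Delta\subseteq\Gamma\times O_n$ finite; configurations are $n$-stores, and $s\hookrightarrow s'$ iff there is $(a,o)\in\Delta$ with $\mathit{top}_1(s)=a$ and $s'=o(s)$ (defined). $\mathsf{E(U,X)}$ formulas: $\varphi::=R\mid\neg\varphi\mid\varphi\wedge\varphi\mid \mathsf{EX}\,\varphi\mid\mathsf{E}[\varphi\,\mathsf{U}\,\varphi]$, where $R$ ranges over regular sets of $n$-stores (given by finite automata). Semantics at a store $s$: $s\models R$ iff $s\in R$; Boolean connectives as usual; $s\models\mathsf{EX}\,\varphi$ iff there is $s'$ with $s\hookrightarrow s'$ and $s'\models\varphi$; $s\models\mathsf{E}[\varphi_1\mathsf{U}\varphi_2]$ iff there exist $m\ge0$ and stores $s=s_0\hookrightarrow s_1\hookrightarrow\cdots\hookrightarrow s_m$ with $s_m\models\varphi_2$ and $s_i\models\varphi_1$ for all $i<m$. *)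

(* Defs.v *)
From Stdlib Require List.
From mathcomp Require Import all_boot.
Set Implicit Arguments. Unset Strict Implicit. Unset Printing Implicit Defensive.

Section HCFP.
Variable Gamma : finType.

Definition ext_alph : finType := (Gamma + bool)%type.
Definition lbr : ext_alph := inr false.
Definition rbr : ext_alph := inr true.

Record dfa (A : finType) := Dfa {
  dfa_size : nat;
  dfa_start : 'I_dfa_size.+1;
  dfa_final : {set 'I_dfa_size.+1};
  dfa_trans : 'I_dfa_size.+1 -> A -> 'I_dfa_size.+1 }.

Definition dfa_accepts (A : finType) (M : dfa A) (u : seq A) : bool :=
  foldl (@dfa_trans A M) (@dfa_start A M) u \in @dfa_final A M.

(** Untyped store trees; [is_store n] carves out the n-stores. *)
Inductive store :=
| SLeaf of seq Gamma          (* a 1-store [a_1 ... a_l] *)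
| SNode of seq store.         (* an n-store [s_1 ... s_l], n >= 2 *)

Fixpoint is_store (n : nat) (s : store) : bool :=
  match n, s with
  | 1, SLeaf _ => true
  | n'.+2, SNode ss => ~~ nilp ss && all (is_store n'.+1) ss
  | _, _ => false
  end.

Fixpoint word (s : store) : seq ext_alph :=
  match s with
  | SLeaf l => lbr :: map inl l ++ [:: rbr]
  | SNode ss => lbr :: flatten (map word ss) ++ [:: rbr]
  end.

Inductive op :=
| Push1 of seq Gamma
| Push of nat
| Pop of nat.

Definition op_in_On (n : nat) (o : op) : Prop :=
  match o with
  | Push1 _ => True
  | Push k | Pop k => 2 <= k <= n
  end.

Fixpoint top1 (s : store) : option Gamma :=
  match s with
  | SLeaf (a :: _) => Some a
  | SNode (s1 :: _) => top1 s1
  | _ => None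
  end.

Fixpoint apply_op (n : nat) (o : op) (s : store) {struct s} : option store :=
  match s with
  | SLeaf l =>
      match n, o, l with
      | 1, Push1 w, _ :: l' => Some (SLeaf (w ++ l'))
      | _, _, _ => None
      end
  | SNode ss =>
      match ss with
      | [::] => None
      | s1 :: rest =>
          let rec := fun o' => match apply_op n.-1 o' s1 with
                               | Some s1' => Some (SNode (s1' :: rest))
                               | None => None end in
          if n <= 1 then None else
          match o with
          | Push1 w => rec (Push1 w)
          | Push k => if k < n then rec (Push k)
                      else if k == n then Some (SNode (s1 :: s1 :: rest))
                      else None
          | Pop k => if k < n then rec (Pop k)
                     else if k == n then
                       (if rest is _ :: _ then Some (SNode rest) else None)
                     else None
          end
      end
  end.

(** An n-HCFP is (Gamma, Delta) with Delta a finite subset of Gamma x O_n,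
    represented by a finite list of rules. *)
Definition hcfp := seq (Gamma * op).

Definition valid_hcfp (n : nat) (Delta : hcfp) : Prop :=
  forall a o, List.In (a, o) Delta -> op_in_On n o.

Definition step (n : nat) (Delta : hcfp) (s s' : store) : Prop :=
  exists a o, List.In (a, o) Delta /\ top1 s = Some a /\ apply_op n o s = Some s'.

(** E(U,X) formulas; atomic predicates are regular sets given by automata
    over Gamma' (the atom denotes the set of stores whose word is accepted). *)
Inductive form :=
| FAtom of dfa ext_alph
| FNeg of form
| FAnd of form & form
| FEX of form
| FEU of form & form.

Fixpoint sat (n : nat) (Delta : hcfp) (s : store) (phi : form) : Prop :=
  match phi with
  | FAtom M => dfa_accepts M (word s)
  | FNeg p => ~ sat n Delta s p
  | FAnd p q => sat n Delta s p /\ sat n Delta s q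
  | FEX p => exists s', step n Delta s s' /\ sat n Delta s' p
  | FEU p q =>
      exists (m : nat) (f : nat -> store),
        f 0 = s /\
        (forall i, i < m -> step n Delta (f i) (f i.+1)) /\
        sat n Delta (f m) q /\
        (forall i, i < m -> sat n Delta (f i) p)
  end.

End HCFP.

(* Main.v *)
Require Import Defs.
From mathcomp Require Import all_boot.
Set Implicit Arguments. Unset Strict Implicit. Unset Printing Implicit Defensive.

(** The operators EX and EU reduce to alternating reachability for order-n
    processes with finitely many control states whose rules are guarded by
    regular sets of stores.  Winning sets of such processes are regular, by
    induction on n.  In a store [t u] of order n + 1 the lower part u matters
    only through its class c for the automaton recognizing the guards and through
    the set S of control states that are allowed when u is uncovered.  So play
    above u is an alternating game of order n on t with states (c, p, S): pushing
    a copy of t guesses the set S1 of states allowed when the lower t is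
    uncovered, and forks into a game above t for S1 and games above u from every
    state of S1.  At order 1 the same decomposition leaves a finite game on
    letters, solved by a least fixpoint. *)

(* Automata reading words from right to left: the class of the lower part of a
   store is known before its topmost store is read. *)
Record raut (A : finType) := Raut {
  rst : finType;
  r0 : rst;
  ract : A -> rst -> rst }.

Definition run (A : finType) (M : raut A) (u : seq A) : rst M :=
  foldr (@ract A M) (r0 M) u.

Definition rprod (A : finType) (M N : raut A) : raut A :=
  @Raut A (rst M * rst N)%type (r0 M, r0 N)
    (fun a x => (ract a x.1, ract a x.2)).

Lemma run_rprod (A : finType) (M N : raut A) u :
  run (rprod M N) u = (run M u, run N u).
Proof. by elim: u => //= a u; rewrite /run /= => ->. Qed.

(** Transition monoid of [M]: it records how a word acts on every class, so a guard on [t] above a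
    lower part becomes a guard on [t] alone once the class of that part is given. *)
Definition rfun (A : finType) (M : raut A) : raut A :=
  @Raut A {ffun rst M -> rst M} [ffun c => c]
    (fun a f => [ffun c => ract a (f c)]).

Lemma run_rfun (A : finType) (M : raut A) u c :
  run (rfun M) u c = foldr (@ract A M) c u.
Proof.
elim: u => [|a u IHu]; first by rewrite ffunE.
by rewrite [LHS]ffunE /= -IHu.
Qed.

(** Reversal by subsets: the state is the set of states of [M] from which the suffix read so far is
    accepted. *)
Definition raut_of_dfa (A : finType) (M : dfa A) : raut A :=
  @Raut A {set 'I_(dfa_size M).+1} (dfa_final M)
    (fun a S => [set q | dfa_trans q a \in S]).

Lemma run_raut_of_dfa (A : finType) (M : dfa A) u :
  (dfa_start M \in run (raut_of_dfa M) u) = dfa_accepts M u.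
Proof.
rewrite /dfa_accepts; move: (dfa_start M).
by elim: u => //= a u IHu q; rewrite inE -IHu.
Qed.

Lemma dfa_of_finType (A Q : finType) (q0 : Q) (F : pred Q) (d : Q -> A -> Q) :
  {M : dfa A | forall u, dfa_accepts M u = F (foldl d q0 u)}.
Proof.
(* Since a [dfa] has a successor number of states, [ord0] is a spare state, never reached and
   decoded as [q0]. *)
pose enc (q : Q) : 'I_#|Q|.+1 := lift ord0 (enum_rank q).
pose dec (i : 'I_#|Q|.+1) : Q := if unlift ord0 i is Some j then enum_val j else q0.
have encK q : dec (enc q) = q by rewrite /dec /enc liftK enum_rankK.
exists (Dfa (enc q0) [set i | F (dec i)] (fun i a => enc (d (dec i) a))) => u.
rewrite /dfa_accepts /=.
suff -> q : foldl (fun i a => enc (d (dec i) a)) (enc q) u = enc (foldl d q u).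
  by rewrite inE encK.
by elim: u q => //= a u IHu q; rewrite encK IHu.
Qed.

Lemma dfa_of_raut (A : finType) (M : raut A) (F : pred (rst M)) :
  {D : dfa A | forall u, dfa_accepts D u = F (run M u)}.
Proof.
(* The state is the action on classes of the prefix read so far. *)
have [D DE] := @dfa_of_finType A {ffun rst M -> rst M} [ffun c => c]
  (fun g => F (g (r0 M))) (fun g a => [ffun c => g (ract a c)]).
exists D => u; rewrite DE.
suff E (g : {ffun rst M -> rst M}) :
    foldl (fun (g : {ffun rst M -> rst M}) a => [ffun c => g (ract a c)]) g u (r0 M) = g (run M u).
  by rewrite E ffunE.
by elim: u g => //= a u IHu g; rewrite IHu ffunE.
Qed.

(** Each state of [S0] brings its own allowed set; since [X] is upward closed, their union serves
    all of [S0] at once. *)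
Lemma finite_choice_union (P : finType) (S0 : {set P}) (X : P -> {set P} -> Prop) (Y : P -> Prop) :
  (forall q (S S' : {set P}), S \subset S' -> X q S -> X q S') ->
  (forall q, q \in S0 -> exists2 S : {set P}, X q S & forall r, r \in S -> Y r) ->
  exists2 S : {set P}, (forall q, q \in S0 -> X q S) & forall r, r \in S -> Y r.
Proof.
move=> Xmono H.
have [f Hf] : exists f : P -> {set P}, forall q, (q \in S0 -> X q (f q)) /\ forall r, r \in f q -> Y r.
  apply: (@fin_all_exists _ (fun=> {set P})
    (fun q S => (q \in S0 -> X q S) /\ forall r, r \in S -> Y r)) => q.
  have [/H[S XS YS]|nq] := boolP (q \in S0); first by exists S.
  by exists set0; split=> // r; rewrite inE.
exists (\bigcup_(q in S0) f q) => [q qS|r /bigcupP[q qS]]; last exact: (Hf q).2.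
exact: (Xmono _ _ _ (bigcup_sup q qS)) ((Hf q).1 qS).
Qed.

Section Stores.
Variable Gamma : finType.
Local Notation A := (ext_alph Gamma).
Local Notation lbr := (lbr Gamma).
Local Notation rbr := (rbr Gamma).
Local Notation store := (store Gamma).

(** * Regularity of the set of words of stores *)

Section StoreWords.
Variable n : nat.

(* Reading from the right, (j, b) means that j brackets are open and that b holds
   iff nothing inside the innermost open store has been read yet (b is ignored at
   j = n, since 1-stores may be empty); None is failure. *)
Let st := option ('I_n.+1 * bool).

Definition sw_act (x : A) (s : st) : st :=
  if s is Some (j, b) then
    match x with
    | inl _ => if j == n :> nat then Some (j, b) else None
    | inr true => if (j < n) && ((0 < j) || b) then Some (inord j.+1, true) else None
    | inr false => if (0 < j) && ((j == n :> nat) || ~~ b)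
                   then Some (inord j.-1, false) else None
    end
  else None.

Definition sw_raut : raut A := @Raut A st (Some (ord0, true)) sw_act.

Definition sw_final (s : st) : bool := if s is Some (j, false) then j == ord0 else false.

Lemma sw_actNone u : foldr sw_act None u = None.
Proof. by elim: u => //= a u ->. Qed.

Lemma sw_complete k s (j : nat) b : 0 < k -> is_store k s -> j + k = n ->
  (0 < j) || b ->
  foldr sw_act (Some (inord j, b)) (word s) = Some (inord j, false).
Proof.
elim: k s j b => // k IHk s j b _ sk jk jb.
have jn : j < n by rewrite -jk addnS ltnS leq_addr.
have jn' := ltnW jn.
case: s k IHk sk jk => [l|ss] [|k] IHk //= sk jk.
  have {}jk : j.+1 = n by rewrite -jk addn1.
  rewrite foldr_cat /= inordK // jn jb /=.
  have -> : foldr sw_act (Some (inord j.+1, true)) (map inl l) = Some (inord j.+1, true).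
    by elim: (l) => //= a l' ->; rewrite /= inordK // jk eqxx.
  by rewrite /= inordK // (introT eqP jk).
rewrite foldr_cat /= inordK // jn jb /=.
have [ss0 ssk] := andP sk.
have -> b' : foldr sw_act (Some (inord j.+1, b')) (flatten (map (@word Gamma) ss))
    = Some (inord j.+1, b' && nilp ss).
  elim: (ss) ssk => [|t ts IHt] /=; first by rewrite andbT.
  case/andP=> tk tsk; rewrite foldr_cat IHt // andbF; apply: IHk => //.
  by rewrite addSnnS.
by rewrite /= inordK // (negbTE ss0) orbT.
Qed.

(** Once the closing bracket of a k-store has been read, acceptance forces its matching opening
    bracket, so a store word splits off at the right end. *)
Lemma sw_sound k u (j : nat) : 0 < k -> j + k = n ->
  sw_final (foldr sw_act (Some (inord j.+1, true)) u) ->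
  exists2 t, is_store k t & exists2 u', rcons u rbr = u' ++ word t &
    sw_final (foldr sw_act (Some (inord j, false)) u').
Proof.
elim: k u j => // k IHk u j _ jk.
have jn : j < n by rewrite -jk addnS ltnS leq_addr.
have jn' := ltnW jn.
case: k IHk jk => [_|k IHk] jk.
  have {}jk : j.+1 = n by rewrite -jk addn1.
  suff H v (l : seq Gamma) b : sw_final (foldr sw_act (Some (inord j.+1, b)) v) ->
    exists2 t, is_store 1 t & exists2 u', v ++ map inl l ++ [:: rbr] = u' ++ word t &
      sw_final (foldr sw_act (Some (inord j, false)) u').
    by move/(H _ [::]); rewrite cats1.
  elim/last_ind: v l b => [|v x IHv] l b.
    by rewrite /= /sw_final; case: b => // /eqP/(congr1 val); rewrite /= inordK.
  rewrite foldr_rcons /= inordK // (introT eqP jk) /= cat_rcons.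
  case: x => [a|[]]; last 1 first.
  - move=> Hv; exists (SLeaf l) => //; exists v => //.
  - exact: (IHv (a :: l)).
  by rewrite [_ < _](_ : _ = false) ?sw_actNone // jk ltnn.
have jkn : j.+1 + k.+1 = n by rewrite -jk addSnnS.
have jn1 : j.+1 < n by rewrite -jkn addnS ltnS leq_addr.
(* [ts] accumulates the components already parsed. Each parse removes a whole component from [v],
   hence the induction on a bound [m] of its length. *)
suff H m v ts b : size v <= m -> b || ~~ nilp ts -> all (is_store k.+1) ts ->
    sw_final (foldr sw_act (Some (inord j.+1, b && nilp ts)) v) ->
    exists2 t, is_store k.+2 t & exists2 u',
      v ++ flatten (map (@word Gamma) ts) ++ [:: rbr] = u' ++ word t &
      sw_final (foldr sw_act (Some (inord j, false)) u').
  by move=> /(H (size u) u [::] true (leqnn _) isT isT); rewrite /= cats1.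
elim: m v ts b => [|m IHm] v ts b; case/lastP: v => [|v x]; rewrite ?size_rcons //.
- move=> _ _ _ /=; case: (b && _) => //= /eqP/(congr1 val).
  by rewrite /= inordK // ltnW.
- move=> _ _ _ /=; case: (b && _) => //= /eqP/(congr1 val).
  by rewrite /= inordK // ltnW.
rewrite ltnS => vm bts tsk; rewrite foldr_rcons /= inordK ?(ltnW jn1) // cat_rcons jn1 /=.
rewrite ltn_eqF //=.
case: x => [a|[]]; rewrite ?sw_actNone //.
  case/(IHk _ _ isT jkn) => t tk [u' Eu' Hu'].
  have := IHm u' (t :: ts) true; rewrite /= tk tsk.
  have su : size u' <= m.
    rewrite (leq_trans _ vm) // -ltnS -(size_rcons v rbr) Eu' size_cat.
    by case: (t) => [l|l] /=; rewrite addnS ltnS leq_addr.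
  case/(_ su isT isT Hu') => t' t'k [u'' E Hu'']; exists t' => //; exists u'' => //.
  by rewrite -E -cat_rcons Eu' -!catA.
case: ifP; rewrite ?sw_actNone // => nb Hv.
exists (SNode ts); last by exists v.
by rewrite /= tsk andbT; case: (b) (nilp ts) bts nb => [] [].
Qed.

Lemma sw_rautP u : 0 < n ->
  reflect (exists2 s, is_store n s & word s = u) (sw_final (run sw_raut u)).
Proof.
move=> n0; apply: (iffP idP) => [|[s sn <-]]; last first.
  have -> : run sw_raut (word s) = Some (inord 0, false).
    rewrite /run /=; have -> : ord0 = inord 0 :> 'I_n.+1 by apply: val_inj; rewrite /= inordK.
    exact: (@sw_complete n).
  by apply/eqP/val_inj; rewrite /= inordK.
rewrite /run; case/lastP: u => [|u x] //=; rewrite foldr_rcons /=.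
case: x => [a|[]]; rewrite /= ?sw_actNone //; first by rewrite ltn_eqF ?sw_actNone.
rewrite n0 => /(sw_sound n0 (add0n n)) [t tn [u' Eu' Hu']]; exists t => //.
rewrite Eu'; case/lastP: u' Hu' Eu' => // u' x; rewrite foldr_rcons /= inordK // n0 /= ltn_eqF //=.
by case: x => [a|[]]; rewrite sw_actNone.
Qed.

End StoreWords.

(** * Alternating games with regular guards *)

Variables (I : finType) (ops : I -> op Gamma).

(* [None] stands for the identity operation. *)
Definition fire (n : nat) (o : option I) (s : store) : option store :=
  if o is Some i then apply_op n (ops i) s else Some s.

(* A rule with S = set0 wins even when the operation o is undefined; otherwise
   o must be defined, since [Win] never holds at [None]. *)
Inductive Win (n : nat) (M : raut A) (P : finType)
    (R : P -> rst M -> option I -> {set P} -> bool) : P -> option store -> Prop :=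
  Win_rule p s o S : R p (run M (word s)) o S ->
    (forall q, q \in S -> Win n R q (fire n o s)) -> Win n R p (Some s).

Lemma Win_None n M P R p : ~ @Win n M P R p None.
Proof. by move=> H; inversion H. Qed.

(** One run decides [Q x] for all [x] simultaneously. This is data, so automata can be computed from
    it. *)
Definition recognized (n : nat) (T : Type) (Q : T -> store -> Prop) :=
  {M : raut A & {F : T -> rst M -> bool |
     forall s, is_store n s -> forall x, Q x s <-> F x (run M (word s))}}.

(** ** Order 1 *)

Section OneStores.
Variables (M : raut A) (P : finType) (R : P -> rst M -> option I -> {set P} -> bool).
Implicit Types (c : rst M) (p q : P) (S : {set P}) (u w : seq Gamma) (x : option Gamma).

(* (c, p, S, x): the item x lies above a word of class c, the control state is p,
   and S is the set of states allowed when x has been consumed.  The item None is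
   a bottom marker, where only identity moves are possible. *)
Let T : finType := (rst M * P * {set P} * option Gamma)%type.
Implicit Types W : {set T}.

Definition word_cls c u := foldr (fun a => @ract A M (inl a)) c u.
Definition tail_cls u := word_cls (ract rbr (r0 M)) u.
Definition item_cls x c := word_cls c (seq_of_opt x).

(** For each letter of the pushed word, the set [S1] of states in which it may be consumed is
    guessed; play on the remaining letters must win from all of [S1]. *)
Fixpoint seq_wins W c S w q : bool :=
  if w is b :: w' then
    [exists S1 : {set P}, ((word_cls c w', q, S1, Some b) \in W) &&
      [forall r in S1, seq_wins W c S w' r]]
  else q \in S.

Definition branch_wins W c S x (o : option I) q : bool :=
  if o is Some i then
    if x is Some _ then
      if ops i is Push1 w then seq_wins W c S w q else false
    else false
  else (c, q, S, x) \in W.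

Definition item_rule W c p S x : bool :=
  [exists o : option I, [exists S0 : {set P},
    R p (ract lbr (item_cls x c)) o S0 && [forall q in S0, branch_wins W c S x o q]]].

(* The clause S' \subset S makes the fixpoint upward closed in S. *)
Definition item_step W : {set T} :=
  [set y : T | let: (c, p, Z, x) := y in
     [exists S' : {set P}, (S' \subset Z) && item_rule W c p S' x]].

Definition item_wins : {set T} := fixset item_step.

Lemma seq_wins_mono W W' c S S' w q : W \subset W' -> S \subset S' ->
  seq_wins W c S w q -> seq_wins W' c S' w q.
Proof.
move=> WW' SS'; elim: w q => [|b w IHw] q /=; first exact: (subsetP SS').
case/existsP=> S1 /andP[/(subsetP WW') H1 /forall_inP H2].
apply/existsP; exists S1; rewrite H1; apply/forall_inP => r /H2; exact: IHw.
Qed.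

Lemma item_rule_mono W W' c p S x : W \subset W' ->
  item_rule W c p S x -> item_rule W' c p S x.
Proof.
move=> WW' /existsP[o /existsP[S0 /andP[Ro /forall_inP H]]].
apply/existsP; exists o; apply/existsP; exists S0; rewrite Ro.
apply/forall_inP => q /H; rewrite /branch_wins; case: (o) (x) => [i|] => [[a|//]|x']; last exact: (subsetP WW').
by case: (ops i) => // w; apply: seq_wins_mono.
Qed.

Lemma item_step_mono : {homo item_step : X Y / X \subset Y}.
Proof.
move=> W W' WW'; apply/subsetP => [[[[c p] S] x]]; rewrite !inE.
case/existsP=> S' /andP[SS' H]; apply/existsP; exists S'.
by rewrite SS' (item_rule_mono WW').
Qed.

Lemma item_winsI c p S x :
  item_rule item_wins c p S x -> (c, p, S, x) \in item_wins.
Proof.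
move=> H; rewrite /item_wins -(fixsetK item_step_mono) inE.
by apply/existsP; exists S; rewrite subxx.
Qed.

Lemma item_wins_mono c p S S' x : S \subset S' ->
  (c, p, S, x) \in item_wins -> (c, p, S', x) \in item_wins.
Proof.
rewrite /item_wins -(fixsetK item_step_mono) !inE => SS' /existsP[S1 /andP[S1S H]].
by apply/existsP; exists S1; rewrite (subset_trans S1S).
Qed.

Lemma run_leaf u : run M (word (SLeaf u)) = ract lbr (tail_cls u).
Proof. by rewrite /run /= foldr_cat /= foldr_map. Qed.

Local Notation win q u := (Win 1 R q (Some (SLeaf u))).

Lemma seq_wins_sound W w u q S :
  (forall c p S b v, (c, p, S, Some b) \in W -> tail_cls v = c ->
     (forall r, r \in S -> win r v) -> win p (b :: v)) ->
  seq_wins W (tail_cls u) S w q -> (forall r, r \in S -> win r u) ->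
  win q (w ++ u).
Proof.
move=> HW Hw HS; elim: w q Hw => [|b w IHw] q /=; first exact: HS.
case/existsP=> S1 /andP[/HW H1 /forall_inP H2]; apply: H1.
  by rewrite /tail_cls /word_cls foldr_cat.
by move=> r /H2/IHw.
Qed.

Lemma item_wins_sound c p S x u : (c, p, S, x) \in item_wins ->
  tail_cls u = c -> (x = None -> u = [::]) ->
  (x -> forall q, q \in S -> win q u) -> win p (seq_of_opt x ++ u).
Proof.
(* Induction on the stage at which the tuple enters the least fixpoint. *)
case/fix_order_proof=> k; elim: k c p S x u => [|k IHk] c p S x u; first by rewrite inE.
rewrite iterS inE => /existsP[S' /andP[/subsetP S'S]].
case/existsP=> o /existsP[S0 /andP[Ro /forall_inP H]] uc xu HS.
apply: (@Win_rule _ _ _ _ _ _ o S0).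
  move: Ro; rewrite run_leaf -uc; by case: (x) xu => [a|->].
move=> q /H {H Ro}; rewrite /branch_wins; case: o => [i|] /=; last first.
  by move/IHk; apply=> // xs r /S'S; apply: HS.
case: x xu HS => // a _ HS /=; case: (ops i) => // w; rewrite -uc.
move/seq_wins_sound; apply => [c' p' S1 b v /IHk H vc Hv|r /S'S]; last exact: HS.
exact: (H v).
Qed.

(** A win on a word splits into one finite game per letter, linked by the sets of states in which
    the letters are consumed. The bottom marker gets [set0], as nothing lies below it. *)
Fixpoint chain1 u q : Prop :=
  if u is a :: u' then
    exists2 S, (tail_cls u', q, S, Some a) \in item_wins & forall r, r \in S -> chain1 u' r
  else (tail_cls [::], q, set0, None) \in item_wins.

Lemma chain1_cat w u q : chain1 (w ++ u) q ->
  exists2 S, seq_wins item_wins (tail_cls u) S w q & forall r, r \in S -> chain1 u r.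
Proof.
elim: w q => [|b w IHw] q /=.
  by move=> H; exists [set q] => [|r]; rewrite inE // => /eqP->.
case=> S1 H1 H2; case: (finite_choice_union _ (fun r rS => IHw r (H2 r rS))).
  by move=> r S S' SS'; apply: seq_wins_mono.
move=> S HS HS'; exists S => //; apply/existsP; exists S1.
apply/andP; split; last exact/forall_inP.
by move: H1; rewrite /tail_cls /word_cls foldr_cat.
Qed.

Lemma chain1P u q : win q u <-> chain1 u q.
Proof.
split; last first.
  elim: u q => [|a u IHu] q /=.
    by move=> H; apply: (item_wins_sound (u := [::]) H).
  by case=> S H HS; apply: (item_wins_sound (u := u) H) => // _ r /HS/IHu.
suff chainI p s : Win 1 R p s -> forall v, s = Some (SLeaf v) -> chain1 v p.
  by move/chainI; apply.
elim=> {u q s} {}p s o S0 Ro HW IH u [Es]; subst s.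
rewrite run_leaf in Ro.
(* Shared by the top letter and the bottom marker: the conjunct [x] is false for [None], which
   forces [S = set0] on the empty word. *)
have lower x v : u = seq_of_opt x ++ v -> (x = None -> v = [::]) ->
    (forall q, q \in S0 -> exists2 S, branch_wins item_wins (tail_cls v) S x o q &
       forall r, r \in S -> x /\ chain1 v r) ->
    exists2 S, (tail_cls v, p, S, x) \in item_wins & forall r, r \in S -> x /\ chain1 v r.
  move=> Eu xv /finite_choice_union[].
    move=> q S S' SS'; rewrite /branch_wins; case: (o) => [i|]; last exact: item_wins_mono.
    by case: (x) => // a; case: (ops i) => // w; apply: seq_wins_mono.
  move=> S H1 H2; exists S => //; apply: item_winsI.
  apply/existsP; exists o; apply/existsP; exists S0.
  apply/andP; split; last exact/forall_inP.
  by move: Ro; rewrite Eu /item_cls /tail_cls; case: (x).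
case: u Ro lower HW IH => [|a u] Ro lower HW IH /=.
  have [||q qS|S H HS] := lower None [::] => //.
    move: (HW q qS) (IH q qS); rewrite /branch_wins; case: (o) => [i|] /=.
      by case: (ops i) => [w|k|k] /Win_None.
    by move=> _ /(_ _ erefl) H; exists set0 => // r; rewrite inE.
  suff <- : S = set0 by [].
  by apply/setP => r; rewrite inE; apply/negP => /HS[].
have [//|//|q qS|S H HS] := lower (Some a) u; last by exists S => // r /HS[].
move: (HW q qS) (IH q qS); rewrite /branch_wins; case: (o) => [i|] /=.
  case: (ops i) => [w _|k /Win_None//|k /Win_None//] /(_ _ erefl)/chain1_cat[S H HS].
  by exists S => // r /HS.
by move=> _ /(_ _ erefl) /= [S H HS]; exists S => // r /HS.
Qed.

Lemma recognized1 : recognized 1 (fun p s => Win 1 R p (Some s)).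
Proof.
(* Besides the class, the state holds the control states satisfying [chain1] on the suffix read so
   far. *)
pose N : raut A := @Raut A (rst M * {set P})%type (r0 M, set0)
  (fun a (x : rst M * {set P}) =>
  (ract a x.1, match a with
     | inl b => [set q | [exists S : {set P}, ((x.1, q, S, Some b) \in item_wins) && (S \subset x.2)]]
     | inr true => [set q | (tail_cls [::], q, set0, None) \in item_wins]
     | inr false => x.2 end)).
exists N, (fun p (y : rst M * {set P}) => p \in y.2) => [[u|//]] _ p; rewrite (chain1P u p) /run /= foldr_cat /=.
set y := foldr _ _ (map inl u).
suff [_ Ey] : y.1 = tail_cls u /\ forall q, chain1 u q <-> q \in y.2 by apply: Ey.
rewrite /y => {y p}; elim: u => [|a u [IH1 IH2]] /=; first by split=> // q; rewrite inE.
split; first by rewrite IH1.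
move=> q; rewrite inE IH1; split.
  case=> S H HS; apply/existsP; exists S; rewrite H; apply/subsetP => r /HS.
  by rewrite IH2.
by case/existsP=> S /andP[H /subsetP HS]; exists S => // r /HS; rewrite IH2.
Qed.

End OneStores.

(** * Automata acting on the components of a store *)

Section Blocks.
Variables (n : nat) (M : raut A) (X : finType) (x0 : X) (upd : rst M -> X -> X).

(* Runs M on each component of a store and applies upd to X with the class
   obtained.  The counter j is the depth inside the current component. *)
Definition block_act (a : A) (y : X * rst M * 'I_n.+1) : X * rst M * 'I_n.+1 :=
  let: (x, d, j) := y in
  let d' := ract a d in
  match a with
  | inl _ => (x, d', j)
  | inr true => (x, d', inord j.+1)
  | inr false => if j == 1 :> nat then (upd d' x, r0 M, ord0) else (x, d', inord j.-1)
  end.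

(** [0 < j] keeps inner brackets from being taken for the end of the component; [j + k <= n] keeps
    the counter in range. *)
Lemma block_act_inner k s x d j : is_store k s -> 0 < j -> j + k <= n ->
  foldr block_act (x, d, inord j) (word s) = (x, foldr (@ract A M) d (word s), inord j).
Proof.
elim: k s d j => [|k IHk] [l|ss] d j; rewrite ?addnS // => sk j0 jk;
  have jn : j < n := leq_ltn_trans (leq_addr k j) jk;
  have jn' : j <= n := ltnW jn.
  rewrite /= !foldr_cat /= inordK //.
  set d' := ract _ d.
  have -> : foldr block_act (x, d', inord j.+1) (map inl l) =
      (x, foldr (@ract A M) d' (map inl l), inord j.+1).
    by elim: (l) => //= a v ->.
  rewrite /= inordK //.
  by case: (j) j0.
case: k IHk sk jk => [//=|k IHk /= /andP[_ sk] jk].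
rewrite /= !foldr_cat /= inordK //.
set d' := ract _ d.
have -> : foldr block_act (x, d', inord j.+1) (flatten (map (@word Gamma) ss)) =
    (x, foldr (@ract A M) d' (flatten (map (@word Gamma) ss)), inord j.+1).
  elim: (ss) sk => //= t ts IHt /andP[tk tsk].
  by rewrite !foldr_cat IHt // IHk.
rewrite /= inordK //.
by case: (j) j0.
Qed.

Lemma block_act_word k s x : 0 < k <= n -> is_store k s ->
  foldr block_act (x, r0 M, ord0) (word s) = (upd (run M (word s)) x, r0 M, ord0).
Proof.
case: k s => [|k] s // kn sk; rewrite /run.
have n0 : 1 <= n by apply: leq_trans kn.
case: s k kn sk => [l|ss] [|k] // kn sk.
  rewrite /= !foldr_cat /=; set d' := ract _ (r0 M).
  have -> : foldr block_act (x, d', inord 1) (map inl l) =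
      (x, foldr (@ract A M) d' (map inl l), inord 1).
    by elim: (l) => //= a v ->.
  by rewrite /= inordK.
case/andP: sk => _ sk; rewrite /= !foldr_cat /=; set d' := ract _ (r0 M).
have -> : foldr block_act (x, d', inord 1) (flatten (map (@word Gamma) ss)) =
    (x, foldr (@ract A M) d' (flatten (map (@word Gamma) ss)), inord 1).
  elim: (ss) sk => //= t ts IHt /andP[tk tsk].
  by rewrite !foldr_cat IHt // (@block_act_inner k.+1).
by rewrite /= inordK.
Qed.

(* The state None is left at the outermost closing bracket; the outermost opening
   bracket is read at depth 0 and does not change the X component. *)
Definition block_raut : raut A :=
  @Raut A (option (X * rst M * 'I_n.+1)) None
    (fun a y => if y is Some z then Some (block_act a z) else Some (x0, r0 M, ord0)).

Definition block_state (y : rst block_raut) : X := if y is Some z then z.1.1 else x0.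

Lemma block_stateP ss : 0 < n -> all (is_store n) ss ->
  block_state (run block_raut (word (SNode ss))) =
  foldr (fun s => upd (run M (word s))) x0 ss.
Proof.
move=> n0 ssn; rewrite /run /= foldr_cat /=.
have -> : foldr (@ract _ block_raut) (Some (x0, r0 M, ord0)) (flatten (map (@word Gamma) ss))
   = Some (foldr (fun s => upd (run M (word s))) x0 ss, r0 M, ord0).
  elim: ss ssn => //= t ts IHt /andP[tn tsn]; rewrite foldr_cat IHt //.
  rewrite -(@block_act_word n) ?n0 ?leqnn //; move: (foldr _ x0 ts) => x.
  by elim: (word t) => //= a v ->.
by [].
Qed.
End Blocks.

(** ** From order n + 1 to order n + 2 *)

Section Lift.
Variable n : nat.
Variables (M : raut A) (P : finType) (R : P -> rst M -> option I -> {set P} -> bool).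
Implicit Types (c : rst M) (p q : P) (S : {set P}) (o : option I) (t : store) (u : seq store).

(* (c, p, S): play from control state p above a lower part of class c, with S the
   states allowed when that lower part is uncovered. *)
Let P' : finType := (rst M * P * {set P})%type.

Definition is_push o := if o is Some i then if ops i is Push k then k == n.+2 else false else false.
Definition is_pop o := if o is Some i then if ops i is Pop k then k == n.+2 else false else false.

(** The first disjunct makes winning upward closed in [Z]. A push becomes an identity move, both
    copies being [t]; [f c] is the class below the upper copy. A pop wins at once when it leads into
    [Z]. *)
Definition lift_rule (x : P') (f : rst (rfun M)) (o : option I) (S' : {set P'}) : bool :=
  let: (c, p, Z) := x in
  (o == None) && [exists S1 : {set P}, (S1 \subset Z) && (S' == [set (c, p, S1)])] ||
  [exists o0 : option I, [exists S0 : {set P}, R p (ract lbr (f c)) o0 S0 &&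
     if is_push o0 then (o == None) && [exists S1 : {set P},
       S' == [set (f c, q, S1) | q in S0] :|: [set (c, q, Z) | q in S1]]
     else if is_pop o0 then [&& o == None, S0 \subset Z & S' == set0]
     else (o == o0) && (S' == [set (c, q, Z) | q in S0])]].

Definition stack_cls u : rst M := run M (flatten (map (@word Gamma) u) ++ [:: rbr]).

Definition substack u : option store := if u is _ :: _ then Some (SNode u) else None.

Lemma run_node u : run M (word (SNode u)) = ract lbr (stack_cls u).
Proof. by []. Qed.

Lemma stack_cls_cons t u :
  stack_cls (t :: u) = run (rfun M) (word t) (stack_cls u).
Proof. by rewrite run_rfun /stack_cls /run /= -catA foldr_cat. Qed.

Lemma fire_push o t u : is_push o ->
  fire n.+2 o (SNode (t :: u)) = Some (SNode (t :: t :: u)).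
Proof.
case: o => //= i; case: (ops i) => // k /eqP->.
by rewrite ltnn eqxx.
Qed.

Lemma fire_pop o t u : is_pop o -> fire n.+2 o (SNode (t :: u)) = substack u.
Proof.
case: o => //= i; case: (ops i) => // k /eqP->.
by rewrite ltnn eqxx.
Qed.

(** Makes both sides of [fire_low] undefined for operations of index above [n.+2]. *)
Lemma apply_op_gt (m : nat) (b : bool) k t : m < k ->
  apply_op m (if b then Push Gamma k else Pop Gamma k) t = None.
Proof.
case: t => [l|[|s ss]] mk; rewrite /=; first by case: m mk => [|[|m]]; case: b.
  by [].
case: ifP => // _; have /negbTE E : k != m by rewrite gtn_eqF.
by case: b; rewrite ltnNge ltnW // E.
Qed.

Lemma fire_low o t u : ~~ is_push o -> ~~ is_pop o ->
  fire n.+2 o (SNode (t :: u)) =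
  omap (fun s => SNode (s :: u)) (fire n.+1 o t).
Proof.
case: o => //= i; case: (ops i) => [w|k|k] //=.
- move/negbTE=> E _; case: ltnP => [//|]; rewrite E leq_eqVlt eq_sym E /=.
  by move/ltnW/(apply_op_gt true)->.
- move=> _ /negbTE E; case: ltnP => [//|]; rewrite E leq_eqVlt eq_sym E /=.
  by move/ltnW/(apply_op_gt false)->.
Qed.

Local Notation W := (Win n.+1 lift_rule).

Lemma lift_weaken c p S S' (t : option store) : S \subset S' -> W (c, p, S) t -> W (c, p, S') t.
Proof.
case: t => [t|]; last by move=> _ /Win_None.
move=> SS' H; apply: (@Win_rule _ _ _ _ _ _ None [set (c, p, S)]).
  by apply/orP; left; rewrite eqxx; apply/existsP; exists S; rewrite SS' eqxx.
by move=> q /set1P->.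
Qed.

Section Rule.
Variables (p : P) (t : store) (u : seq store) (o : option I) (S0 : {set P}).
Hypothesis Ro : R p (run M (word (SNode (t :: u)))) o S0.

Let Ro' : R p (ract lbr (run (rfun M) (word t) (stack_cls u))) o S0.
Proof. by rewrite -stack_cls_cons. Qed.

Lemma lift_push S S1 : is_push o ->
  (forall q, q \in S0 -> W (stack_cls (t :: u), q, S1) (Some t)) ->
  (forall q, q \in S1 -> W (stack_cls u, q, S) (Some t)) ->
  W (stack_cls u, p, S) (Some t).
Proof.
move=> po H0 H1; apply: (@Win_rule _ _ _ _ _ _ None
  ([set (stack_cls (t :: u), q, S1) | q in S0] :|: [set (stack_cls u, q, S) | q in S1])).
  apply/orP; right; apply/existsP; exists o; apply/existsP; exists S0.
  by rewrite Ro' po; apply/existsP; exists S1; rewrite -stack_cls_cons eqxx.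
by move=> x /setUP[/imsetP[q qS ->]|/imsetP[q qS ->]]; [apply: H0|apply: H1].
Qed.

Lemma lift_pop S : ~~ is_push o -> is_pop o -> S0 \subset S ->
  W (stack_cls u, p, S) (Some t).
Proof.
move=> npo po S0S; apply: (@Win_rule _ _ _ _ _ _ None set0).
  apply/orP; right; apply/existsP; exists o; apply/existsP; exists S0.
  by rewrite Ro' po (negbTE npo) S0S eqxx.
by move=> x; rewrite inE.
Qed.

Lemma lift_low S : ~~ is_push o -> ~~ is_pop o ->
  (forall q, q \in S0 -> W (stack_cls u, q, S) (fire n.+1 o t)) ->
  W (stack_cls u, p, S) (Some t).
Proof.
move=> npo npo' H; apply: (@Win_rule _ _ _ _ _ _ o
  [set (stack_cls u, q, S) | q in S0]).
  apply/orP; right; apply/existsP; exists o; apply/existsP; exists S0.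
  by rewrite Ro' (negbTE npo') (negbTE npo) !eqxx.
by move=> x /imsetP[q /H ? ->].
Qed.
End Rule.

Lemma lift_sound x s : W x s -> forall t u, s = Some t -> x.1.1 = stack_cls u ->
  (forall q, q \in x.2 -> Win n.+2 R q (substack u)) ->
  Win n.+2 R x.1.2 (Some (SNode (t :: u))).
Proof.
elim=> {x s} [[[c p] S]] s o S' /= rule HW IH t u [<-{t}] Ec HS; subst c.
case/orP: rule => [|/existsP[o0 /existsP[S0 /andP[Ro]]]].
  case/andP=> /eqP Eo /existsP[S1 /andP[/subsetP S1S /eqP ES']]; subst o S'.
  by apply: (IH _ (set11 _)) => //= q /S1S/HS.
rewrite -stack_cls_cons -run_node in Ro.
have [po|npo] := boolP (is_push o0).
  case/andP=> /eqP Eo /existsP[S1 /eqP ES']; subst o S'.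
  apply: (Win_rule (S := S0) Ro) => q qS0; rewrite fire_push //.
  pose c := run (rfun M) (word s) (stack_cls u).
  (* The upper copy of [s] is played over [s :: u]; when it is popped into a state of [S1], the
     other family of successors wins from the lower copy. *)
  apply: (IH (c, q, S1)) => //=.
  - by rewrite inE (imset_f (fun q => (c, q, S1))).
  - by rewrite stack_cls_cons.
  move=> r rS1; apply: (IH (stack_cls u, r, S)) => //=.
  by rewrite inE orbC (imset_f (fun q => (stack_cls u, q, S))).
have [po|npo'] := boolP (is_pop o0).
  case/and3P=> /eqP Eo /subsetP S0S _.
  by apply: (Win_rule Ro) => q qS0; rewrite fire_pop //; apply/HS/S0S.
case/andP=> /eqP Eo /eqP ES'; subst o S'.
apply: (Win_rule Ro) => q qS0; rewrite fire_low //.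
have xS : (stack_cls u, q, S) \in [set (stack_cls u, q, S) | q in S0].
  exact: (imset_f (fun q => (stack_cls u, q, S))).
move: (HW _ xS) (IH _ xS).
case: (fire _ _ s) => [s' _|/Win_None//] /= H; exact: H.
Qed.

(** Counterpart of [chain1]. The empty case is [False] because the last component cannot be popped:
    the game above it must be won with [S] empty. *)
Fixpoint chain u q : Prop :=
  if u is t :: u' then
    exists2 S, W (stack_cls u', q, S) (Some t) & forall r, r \in S -> chain u' r
  else False.

Lemma chainP u q : Win n.+2 R q (substack u) <-> chain u q.
Proof.
split; last first.
  elim: u q => //= t u IHu q [S HW HS].
  by apply: (lift_sound HW) => //= r /HS/IHu.
suff chainI p s : Win n.+2 R p s -> forall v, s = substack v -> chain v p.
  by move/chainI; apply.
elim=> {u q p s} p s o S0 Ro HW IH [|t u] //= [Es]; subst s.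
have [po|npo] := boolP (is_push o).
  have IH' q : q \in S0 -> chain (t :: t :: u) q.
    by move=> qS0; apply: IH => //; rewrite fire_push.
  (* [S1] links the upper copy of [t] to the lower one, and [S2] links the lower copy to [u]. *)
  case: (finite_choice_union _ IH') => [q S S' SS'|S1 H1]; first exact: lift_weaken.
  case/finite_choice_union => [q S S' SS'|S2 H2 HS]; first exact: lift_weaken.
  by exists S2 => //; apply: (lift_push Ro _ H1).
have [po|npo'] := boolP (is_pop o).
  exists S0; first exact: (lift_pop Ro).
  by move=> r rS; apply: IH => //; rewrite fire_pop.
have IH' q : q \in S0 -> exists2 S : {set P}, W (stack_cls u, q, S) (fire n.+1 o t) &
    forall r, r \in S -> chain u r.
  move=> qS; move: (HW q qS) (IH q qS); rewrite fire_low //.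
  by case: (fire _ _ t) => [t' _ /(_ (t' :: u) erefl)|/Win_None].
case: (finite_choice_union _ IH') => [q S S' SS'|S H HS]; first exact: lift_weaken.
by exists S => //; apply: (lift_low Ro).
Qed.

Lemma recognized_lift :
  recognized n.+1 (fun x s => W x (Some s)) ->
  recognized n.+2 (fun p s => Win n.+2 R p (Some s)).
Proof.
case=> N [F FP]; pose X : finType := (rst M * {set P})%type.
(* [x] holds the class of the lower part and the states satisfying [chain] there, so the game on the
   next component can be tested at [(x.1, q, S)]. *)
pose upd (y : rst (rprod N (rfun M))) (x : X) : X :=
  (y.2 x.1, [set q | [exists S : {set P}, F (x.1, q, S) y.1 && (S \subset x.2)]]).
pose x0 : X := (ract rbr (r0 M), set0).
exists (block_raut n.+1 x0 upd),
  (fun p b => p \in (@block_state n.+1 (rprod N (rfun M)) X x0 upd b).2) => [[//|[|t u]]] // /andP[_ uk] p.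
rewrite block_stateP // (chainP (t :: u)); move: (t :: u) uk => {t}u uk.
set y := foldr _ _ u.
suff [_ Ey] : y.1 = stack_cls u /\ forall q, chain u q <-> q \in y.2 by apply: Ey.
rewrite /y => {y p}; elim: u uk => [|t u IHu] /=; first by split=> // q; rewrite inE.
case/andP=> tk /IHu[IH1 IH2]; rewrite run_rprod IH1 /= stack_cls_cons; split=> // q.
rewrite inE; split.
  case=> S H HS; apply/existsP; exists S; apply/andP; split; first by rewrite -FP.
  by apply/subsetP => r /HS; rewrite IH2.
by case/existsP=> S /andP[]; rewrite -FP // => H /subsetP HS; exists S => // r /HS; rewrite IH2.
Qed.

End Lift.

Theorem recognized_Win n (M : raut A) (P : finType)
    (R : P -> rst M -> option I -> {set P} -> bool) :
  recognized n.+1 (fun p s => Win n.+1 R p (Some s)).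
Proof.
elim: n M P R => [|n IHn] M P R; first exact: recognized1.
exact/recognized_lift/IHn.
Qed.

End Stores.

(** ** The logic *)

(** Rules are indexed by position to obtain a finite type, which [op Gamma] is not. *)
Lemma In_tnth (T : Type) (x : T) (l : seq T) :
  List.In x l <-> exists i : 'I_(size l), tnth (in_tuple l) i = x.
Proof.
elim: l => [|y l IHl] /=; first by split=> // -[[]].
split=> [[->|/IHl[i Ei]]|[i]]; first by exists ord0.
  by exists (lift ord0 i); rewrite -Ei !(tnth_nth x).
case: (unliftP ord0 i) => [j ->|->] Ej; last by left.
by right; apply/IHl; exists j; rewrite -Ej !(tnth_nth x).
Qed.

Lemma is_store_apply_op (Gamma : finType) n o (s s' : store Gamma) :
  is_store n s -> apply_op n o s = Some s' -> is_store n s'.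
Proof.
elim: n o s s' => [|n IHn] o [l|[|t u]] s' //.
  by case: n {IHn} => [|n] //; case: o l => [w|k|k] [|a l] //= _ [<-].
case: n IHn => // n IHn /= /andP[tn un].
have rec o' : (if apply_op n.+1 o' t is Some t' then Some (SNode (t' :: u)) else None)
    = Some s' -> is_store n.+2 s'.
  by case E: apply_op => [t'|//] [<-] /=; rewrite (IHn _ _ _ tn E) un.
case: o => [w|k|k] /=; first exact: rec.
  by case: ifP => _; [exact: rec|case: ifP => // _ [<-] /=; rewrite tn un].
case: ifP => _; first exact: rec.
by case: ifP => // _; case: u un {rec} => // t' u un [<-].
Qed.

Section Logic.
Variable Gamma : finType.
Local Notation A := (ext_alph Gamma).
Local Notation store := (store Gamma).

(* The state is the last symbol read, from right to left, that is not an
   opening bracket: on the word of a store this is the top letter, or a closing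
   bracket when the topmost 1-store is empty. *)
Definition top_raut : raut A :=
  @Raut A (option A) None (fun a x => if a == lbr Gamma then x else Some a).

Definition top_letter (x : rst top_raut) : option Gamma :=
  if x is Some (inl a) then Some a else None.

Lemma top_letterP n s : is_store n s ->
  top_letter (run top_raut (word s)) = top1 s.
Proof.
rewrite /run; move: (r0 _) => x; elim: n s x => [|n IHn] [l|[|t u]] x //.
  by case: n {IHn} => // _; case: l.
case: n IHn => // n IHn /= /andP[tn _].
by rewrite /= -catA foldr_cat IHn.
Qed.

Variables (n : nat) (Delta : hcfp Gamma).
Let I : finType := 'I_(size Delta).
Let rule (i : I) : Gamma * op Gamma := tnth (in_tuple Delta) i.
Let ops (i : I) := (rule i).2.

Lemma stepP s s' : step n Delta s s' <->
  exists2 i, top1 s = Some (rule i).1 & apply_op n (ops i) s = Some s'.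
Proof.
split=> [[a [o [/In_tnth[i Ei] [top Es']]]]|[i top Es']].
  by exists i; rewrite /ops /rule Ei.
exists (rule i).1, (ops i); split=> //; apply/In_tnth; exists i.
by rewrite -surjective_pairing.
Qed.

Lemma is_store_step s s' : is_store n s -> step n Delta s s' -> is_store n s'.
Proof. by move=> sn /stepP[i _]; apply: is_store_apply_op. Qed.

Definition recognized_set (Q : store -> Prop) := recognized n (fun (_ : unit) s => Q s).

Lemma recognized_set_iff (Q Q' : store -> Prop) :
  (forall s, is_store n s -> Q s <-> Q' s) -> recognized_set Q -> recognized_set Q'.
Proof.
move=> QQ' [M [F FP]]; exists M, F => s sn x.
by apply: iff_trans (FP s sn x); apply: iff_sym; apply: QQ'.
Qed.

Hypothesis n0 : 0 < n.

Lemma recognized_set_Win (M : raut A) (P : finType)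
    (R : P -> rst M -> option I -> {set P} -> bool) p :
  recognized_set (fun s => Win ops n R p (Some s)).
Proof.
have [N [F FP]] : recognized n (fun p s => Win ops n R p (Some s)).
  by case: n n0 => // k _; apply: recognized_Win.
by exists N, (fun _ => F p) => s sn _; apply: FP.
Qed.

Lemma recognized_EX (Q : store -> Prop) : recognized_set Q ->
  recognized_set (fun s => exists s', step n Delta s s' /\ Q s').
Proof.
case=> M [F FP]; pose N := rprod M top_raut.
(* State [true] must fire one enabled rule and move to [false], which wins exactly on [Q]. *)
pose R (b : bool) (c : rst N) (o : option I) (S : {set bool}) :=
  if b then (if o is Some i then top_letter c.2 == Some (rule i).1 else false) && (S == [set false])
  else [&& o == None, F tt c.1 & S == set0].
apply: recognized_set_iff (recognized_set_Win R true) => s sn; split=> [W|[s' [st Qs']]].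
  inversion W as [p s1 [i|] S Rs WS]; subst; move: Rs; rewrite /R // run_rprod /= (top_letterP sn).
  case/andP=> /eqP top /eqP ES; have := WS false; rewrite ES inE eqxx => /(_ isT) /=.
  case E: apply_op => [s'|]; last by move/Win_None.
  move=> W'; have st : step n Delta s s' by apply/stepP; exists i.
  exists s'; split=> //; apply/(FP s' (is_store_step sn st) tt).
  by inversion W' as [p' s2 o S' Rs' WS']; subst; move: Rs'; rewrite /R run_rprod => /and3P[].
have sn' := is_store_step sn st; case/stepP: st => i top Es'.
apply: (@Win_rule _ _ _ _ _ _ _ _ _ (Some i) [set false]).
  by rewrite /R run_rprod /= (top_letterP sn) top !eqxx.
move=> b /set1P->; rewrite /= Es'; apply: (@Win_rule _ _ _ _ _ _ _ _ _ None set0).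
  by rewrite /R run_rprod /= !eqxx andbT; apply/(FP s' sn' tt).
by move=> b'; rewrite inE.
Qed.

Lemma recognized_EU (Q1 Q2 : store -> Prop) :
  recognized_set Q1 -> recognized_set Q2 ->
  recognized_set (fun s => exists (m : nat) (f : nat -> store),
    f 0 = s /\ (forall i, i < m -> step n Delta (f i) (f i.+1)) /\
    Q2 (f m) /\ (forall i, i < m -> Q1 (f i))).
Proof.
case=> M1 [F1 F1P] [M2 [F2 F2P]]; pose N := rprod (rprod M1 M2) top_raut.
(* Either stop in [Q2] or fire a rule from [Q1]; [Win] is inductive, so [Q2] is reached after
   finitely many steps. *)
pose R (x : unit) (c : rst N) (o : option I) (S : {set unit}) :=
  if o is Some i then [&& F1 tt c.1.1, top_letter c.2 == Some (rule i).1 & S == setT]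
  else F2 tt c.1.2 && (S == set0).
apply: recognized_set_iff (recognized_set_Win R tt) => s sn; split; last first.
  case=> m [f [Es [st [Qm Qi]]]]; subst s.
  elim: m f sn st Qm Qi => [|m IHm] f sn st Qm Qi.
    apply: (@Win_rule _ _ _ _ _ _ _ _ _ None set0).
      by rewrite /R !run_rprod /= eqxx andbT; apply/(F2P _ sn tt).
    by move=> x; rewrite inE.
  have st0 := st 0 isT; have sn' := is_store_step sn st0.
  have W1 := IHm (fun i => f i.+1) sn' (fun i => st i.+1) Qm (fun i => Qi i.+1).
  case/stepP: st0 => i top E.
  apply: (@Win_rule _ _ _ _ _ _ _ _ _ (Some i) setT).
    rewrite /R !run_rprod /= (top_letterP sn) top !eqxx /= andbT.
    exact/(F1P _ sn tt)/Qi.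
  by case=> _; rewrite /= E.
suff H x os : Win ops n R x os -> forall s, os = Some s -> is_store n s ->
    exists (m : nat) (f : nat -> store), f 0 = s /\
      (forall i, i < m -> step n Delta (f i) (f i.+1)) /\
      Q2 (f m) /\ (forall i, i < m -> Q1 (f i)).
  by move/H; apply.
elim=> {x os s sn} x s o S Rs HW IH _ [<-] sn; move: Rs; rewrite /R !run_rprod /=.
case: o HW IH => [i|] HW IH; last first.
  by case/andP=> /(F2P s sn tt) Q2s _; exists 0, (fun=> s).
rewrite (top_letterP sn) => /and3P[/(F1P s sn tt) Q1s /eqP top /eqP ES].
have ttS : tt \in S by rewrite ES inE.
move: (HW tt ttS) (IH tt ttS) => /=; case E: apply_op => [s'|]; last by move/Win_None.
have st : step n Delta s s' by apply/stepP; exists i.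
move=> _ /(_ s' erefl (is_store_step sn st)) [m [f [f0 [fst [Qm Qi]]]]].
exists m.+1, (fun i => if i is j.+1 then f j else s); split=> //; split; last by split=> // -[].
by case=> [|j]; rewrite ?f0 //; apply: fst.
Qed.

Lemma recognized_sat phi : recognized_set (fun s => sat n Delta s phi).
Proof.
elim: phi => /= [M|p [M [F FP]]|p [M1 [F1 F1P]] q [M2 [F2 F2P]]|p IHp|p IHp q IHq].
- exists (raut_of_dfa M), (fun _ => fun S : {set _} => dfa_start M \in S) => s _ _.
  by rewrite run_raut_of_dfa.
- exists M, (fun x c => ~~ F x c) => s sn x; rewrite (FP s sn x).
  by split=> /negP.
- exists (rprod M1 M2), (fun x c => F1 x c.1 && F2 x c.2) => s sn x.
  by rewrite run_rprod (F1P s sn x) (F2P s sn x); split=> /andP.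
- exact: (recognized_EX IHp).
- exact: (recognized_EU IHp IHq).
Qed.

(** [recognized_set] speaks only about words of stores; the product with [sw_raut] rejects all other
    words. *)
Lemma dfa_of_recognized (Q : store -> Prop) : recognized_set Q ->
  {D : dfa A | forall u, dfa_accepts D u <->
     exists s, [/\ is_store n s, word s = u & Q s]}.
Proof.
case=> M [F FP].
have [D DP] := @dfa_of_raut A (rprod (sw_raut Gamma n) M)
  (fun x => sw_final x.1 && F tt x.2).
exists D => u; rewrite DP run_rprod /=; split.
  case/andP=> /(sw_rautP _ n0)[s sn <-] /(FP s sn tt) Qs.
  by exists s; split.
case=> s [sn <- /(FP s sn tt) Fs]; apply/andP; split=> //.
by apply/(sw_rautP _ n0); exists s.
Qed.

End Logic.

(* Effective computability rendered as a Rocq function computing an automaton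
   from (n, Delta, phi); its language is exactly the set of words of the
   n-stores satisfying phi in the n-HCFP (Gamma, Delta). *)
Theorem theorem4 (Gamma : finType) :
  { f : nat -> hcfp Gamma -> form Gamma -> dfa (ext_alph Gamma) |
    forall (n : nat) (Delta : hcfp Gamma) (phi : form Gamma),
      1 <= n -> valid_hcfp n Delta ->
      forall u : seq (ext_alph Gamma),
        dfa_accepts (f n Delta phi) u <->
        exists s : store Gamma,
          [/\ is_store n s, word s = u & sat n Delta s phi] }.
Proof.
pose f n Delta phi : dfa (ext_alph Gamma) :=
  if n is k.+1 then sval (dfa_of_recognized (ltn0Sn k) (recognized_sat Delta (ltn0Sn k) phi))
  (* Default value at order 0, excluded by [1 <= n]. *)
  else Dfa (ord0 : 'I_1) set0 (fun i _ => i).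
by exists f => -[|k] // Delta phi _ _; apply: (svalP (dfa_of_recognized _ _)).
Qed.
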